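(* Suppose $r\ge2$ and $s\ge0$ are integers. Let $a_1,\dots,a_r,b_1,\dots,b_s,c\in\mathbb{C}$ with $c,b_1,\dots,b_s\notin\{0,-1,-2,\dots\}$, and write $\mathbf a=(a_1,\dots,a_r)$, $\mathbf b=(b_1,\dots,b_s)$ (when $s=0$, parameter vectors and products indexed by the $b_j$ are empty). Define $$ \begin{aligned} A&=F\!\left(\begin{matrix}a_1,\,\mathbf a_{[1]}+1\\ c+1,\,\mathbf b+1\end{matrix}\middle|z\right),& B&=F\!\left(\begin{matrix}a_2,\,\mathbf a_{[2]}+1\\ c+1,\,\mathbf b+1\end{matrix}\middle|z\right),& C&=F\!\left(\begin{matrix}a_2-1,\,\mathbf a_{[2]}\\ c,\,\mathbf b\end{matrix}\middle|z\right),\\ D&=F\!\left(\begin{matrix}a_1-1,\,\mathbf a_{[1]}\\ c,\,\mathbf b\end{matrix}\middle|z\right),& E&=F\!\left(\begin{matrix}\mathbf a\\ c,\,\mathbf b\end{matrix}\middle|z\right),& H&=F\!\left(\begin{matrix}a_1,\,a_2,\,\mathbf a_{[1,2]}+1\\ c,\,\mathbf b+1\end{matrix}\middle|z\right). \end{aligned} $$ Then the following identity holds as a formal power series in $z$, and hence wherever the displayed series converge: $$a_1(a_2-c)\,BD-a_2(a_1-c)\,AC-c(a_2-a_1)\,EH=z\,\frac{a_1a_2\cdots a_r\,(a_1-a_2)}{c\,b_1\cdots b_s}\,AB.$$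
   Context: $F\!\left(\begin{smallmatrix}\mathbf x\\ \mathbf y\end{smallmatrix}\middle|z\right)=\sum_{k\ge0}\frac{\prod_i(x_i)_k}{\prod_i(y_i)_k}\frac{z^k}{k!}$ is the generalized hypergeometric series (here with $r$ upper and $s+1$ lower parameters), $(x)_k=\Gamma(x+k)/\Gamma(x)$. $\mathbf a_{[i]}$ is $\mathbf a$ with component $a_i$ removed, $\mathbf a_{[1,2]}$ is $\mathbf a$ with $a_1,a_2$ removed; adding $1$ to a vector is componentwise. *)

(* Defs.v *)
From mathcomp Require Import all_boot all_order all_algebra.
From mathcomp Require Export complex.
From mathcomp Require Import all_classical all_reals all_analysis.

Set Implicit Arguments.
Unset Strict Implicit.
Unset Printing Implicit Defensive.

Import GRing.Theory Num.Theory.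
Import numFieldNormedType.Exports.

Local Open Scope ring_scope.

(* The value of Gamma(x + k) / Gamma(x), extended by continuity to the poles
   of Gamma: x (x + 1) ... (x + k - 1). *)
Definition pochhammer (K : fieldType) (x : K) (k : nat) : K :=
  \prod_(i < k) (x + i%:R).

(* A formal power series is its sequence of coefficients. *)
Definition fps (K : fieldType) : Type := nat -> K.

Definition fps_mul (K : fieldType) (f g : fps K) : fps K :=
  fun n => \sum_(i < n.+1) f i * g (n - i)%N.

Definition fps_mulX (K : fieldType) (f : fps K) : fps K :=
  fun n => if n is m.+1 then f m else 0.

(* Only meaningful when no entry of y is a nonpositive integer: otherwise a
   coefficient divides by 0. *)
Definition hypergeom (K : fieldType) (x y : seq K) : fps K :=
  fun k => (\prod_(t <- x) pochhammer t k) / (\prod_(t <- y) pochhammer t k)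
           / k`!%:R.

Definition shift1 (K : fieldType) (x : seq K) : seq K := [seq t + 1 | t <- x].

(* Positions are counted from 0. *)
Definition omit (T : Type) (i : nat) (x : seq T) : seq T :=
  take i x ++ drop i.+1 x.

Definition nonpos_integer (K : fieldType) (x : K) : Prop :=
  exists n : nat, x = - n%:R.

(* Convergence is that of the partial sums, hence possibly conditional. *)
Definition fps_cvg (K : numFieldType) (f : fps K) (z : K) : Prop :=
  cvgn (series (fun k : nat => f k * z ^+ k)).

Definition fps_eval (K : numFieldType) (f : fps K) (z : K) : K :=
  limn (series (fun k : nat => f k * z ^+ k)).

(* Main.v *)
(** The identity is bilinear in three linear relations between contiguous
    series.  Writing [P = a_3 ... a_r / (b_1 ... b_s)],
      [c (a_2 - a_1) H = a_1 (a_2 - c) B - a_2 (a_1 - c) A],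
      [D = E - (a_2 P / c) z A],  [C = E - (a_1 P / c) z B].
    Substituting, the terms in [E] cancel and [z A B] is left with the factor
    [(P / c) a_1 a_2 ((a_1 - c) - (a_2 - c))].  Since the relations are linear,
    they pass to the sums of the series, so that no theorem on products of
    (possibly conditionally) convergent series is involved. *)
Require Import Defs.
From mathcomp Require Import all_boot all_order all_algebra.
From mathcomp Require Import complex ring.
From mathcomp Require Import all_classical all_reals all_analysis.

Set Implicit Arguments.
Unset Strict Implicit.
Unset Printing Implicit Defensive.

Import GRing.Theory Num.Theory.
Import numFieldNormedType.Exports.

Local Open Scope ring_scope.
Local Open Scope complex_scope.

Section Pochhammer.
Variable K : fieldType.
Implicit Types (x : K) (s : seq K).

Lemma pochhammer0 x : pochhammer x 0 = 1.
Proof. by rewrite /pochhammer big_ord0. Qed.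

Lemma pochhammerSr x k : pochhammer x k.+1 = pochhammer x k * (x + k%:R).
Proof. by rewrite /pochhammer big_ord_recr. Qed.

Lemma pochhammerSl x k : pochhammer x k.+1 = x * pochhammer (x + 1) k.
Proof.
rewrite /pochhammer big_ord_recl addr0; congr (_ * _).
by apply: eq_bigr => i _; rewrite /bump /= natrD addrA.
Qed.

(** Both sides are [pochhammer x k.+1], with its first or its last factor split off. The form is
    free of division because upper parameters may vanish. *)
Lemma pochhammer_shift x k : x * pochhammer (x + 1) k = pochhammer x k * (x + k%:R).
Proof. by rewrite -pochhammerSl pochhammerSr. Qed.

Lemma prod_pochhammerS s k :
  \prod_(t <- s) pochhammer t k.+1 =
  (\prod_(t <- s) t) * \prod_(t <- shift1 s) pochhammer t k.
Proof.
by rewrite /shift1 big_map -big_split; apply: eq_bigr => t _; rewrite pochhammerSl.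
Qed.

Lemma hypergeom0 s t : hypergeom s t 0 = 1.
Proof.
by rewrite /hypergeom !big1 ?divr1 // => x _; rewrite pochhammer0.
Qed.

Lemma hypergeom_swap x y s t : hypergeom [:: x, y & s] t = hypergeom [:: y, x & s] t.
Proof. by apply/funext => k; rewrite /hypergeom !big_cons mulrCA. Qed.

End Pochhammer.

Section Contiguous.
Variable K : numFieldType.
Implicit Types (x y c : K) (s t : seq K).

(** In degree [k.+1] the first parameters contribute $(x-1)(x)_k$ and $(x)_k(x+k)$. They differ by
    $(k+1)(x)_k$, and $k+1$ cancels against $(k+1)!$, which leaves a coefficient of degree [k]. *)
Lemma hypergeom_pred x s t k :
  hypergeom (x - 1 :: s) t k = hypergeom (x :: s) t k
    - (\prod_(u <- s) u) / (\prod_(u <- t) u)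
      * fps_mulX (hypergeom (x :: shift1 s) (shift1 t)) k.
Proof.
case: k => [|k] /=; first by rewrite !hypergeom0 mulr0 subr0.
rewrite /hypergeom !big_cons !prod_pochhammerS.
rewrite (pochhammerSl (x - 1)) subrK (pochhammerSr x) factS natrM !invfM.
have k1_neq0 : k.+1%:R != 0 :> K by rewrite pnatr_eq0.
(* This form keeps the link between [k] and [k.+1] once the latter is generalized to [d]. *)
have -> : x - 1 = x + k%:R - k.+1%:R by rewrite -natr1; ring.
move: k.+1%:R k1_neq0 => d d_neq0.
set T := (\prod_(u <- t) u)^-1; set U := (\prod_(u <- shift1 t) _)^-1.
set F := k`!%:R^-1; by field.
Qed.

(** After removal of the common factors, with $(c)_k/(c+1)_k = c/(c+k)$, this is
    $(y-c)(x+k)-(x-c)(y+k)=(y-x)(c+k)$. *)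
Lemma hypergeom_contiguous x y c s t k : ~ nonpos_integer c ->
  c * (y - x) * hypergeom [:: x, y & s] (c :: t) k =
  x * (y - c) * hypergeom [:: y, x + 1 & s] (c + 1 :: t) k
    - y * (x - c) * hypergeom [:: x, y + 1 & s] (c + 1 :: t) k.
Proof.
move=> c_pos.
have cDn_neq0 n : c + n%:R != 0.
  by apply/eqP => /eqP; rewrite addr_eq0 => /eqP ?; apply: c_pos; exists n.
have c_neq0 : c != 0 by rewrite -[c]addr0 (cDn_neq0 0).
have pc_neq0 : pochhammer c k != 0 by apply/prodf_neq0 => i _.
rewrite /hypergeom !big_cons.
have -> : pochhammer (c + 1) k = pochhammer c k * (c + k%:R) / c.
  by rewrite -pochhammer_shift mulrC mulKf.
rewrite !invfM invrK.
have := pochhammer_shift x k; have := pochhammer_shift y k.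
set px := pochhammer x k; set py := pochhammer y k.
set qx := pochhammer (x + 1) k; set qy := pochhammer (y + 1) k.
set S := \prod_(u <- s) _; set T := (\prod_(u <- t) _)^-1; set F := _%:R^-1.
move=> eqy eqx.
(* Regrouped so that [x * qx] and [y * qy] occur literally, ready for [eqx] and [eqy]. *)
transitivity ((y - c) * (py * (x * qx) * S * ((pochhammer c k)^-1 * (c + k%:R)^-1 * c * T) * F)
  - (x - c) * (px * (y * qy) * S * ((pochhammer c k)^-1 * (c + k%:R)^-1 * c * T) * F)); last by ring.
by rewrite eqx eqy; field; rewrite cDn_neq0 pc_neq0.
Qed.

End Contiguous.

Section CauchyProduct.
Variable K : fieldType.
Implicit Types (f g h : fps K) (x y : K).

Lemma fps_mulC f g : fps_mul f g = fps_mul g f.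
Proof.
apply/funext => n; rewrite /fps_mul (reindex_inj rev_ord_inj) /=.
by apply: eq_bigr => i _; rewrite mulrC subSS subKn // -ltnS.
Qed.

Lemma fps_mul_lin f g x h y :
  fps_mul f (fun n => x * g n + y * h n) =
  fun n => x * fps_mul f g n + y * fps_mul f h n.
Proof.
apply/funext => n; rewrite /fps_mul !mulr_sumr -big_split.
by apply: eq_bigr => i _ /=; ring.
Qed.

Lemma fps_mul_mulX f g : fps_mul f (fps_mulX g) = fps_mulX (fps_mul f g).
Proof.
apply/funext => -[|n]; rewrite /fps_mul /=.
  by rewrite big_ord_recr big_ord0 /= mulr0 addr0.
rewrite big_ord_recr /= subnn mulr0 addr0.
by apply: eq_bigr => i _; rewrite subSn // -ltnS.
Qed.

End CauchyProduct.

Section Evaluation.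
Local Open Scope classical_set_scope.
Variable K : numFieldType.
Implicit Types (f g : fps K) (x y z : K).

(** The constant term is 0, so the partial sum with [n.+1] terms is [z] times that of [f] with [n]
    terms. *)
Lemma fps_cvg_mulX f z : fps_cvg f z ->
  series (fun k => fps_mulX f k * z ^+ k) @ \oo --> z * fps_eval f z.
Proof.
move=> cvf; rewrite -cvg_shiftS /=.
rewrite (_ : (fun n => _) = (fun n => z * series (fun k => f k * z ^+ k) n)).
  exact: cvgMl_tmp cvf.
apply/funext => n; rewrite !seriesEnat /= big_nat_recl //= mul0r add0r mulr_sumr.
by apply: eq_bigr => i _; rewrite exprS mulrCA.
Qed.

(** The limits [u] and [v] are left arbitrary so that the sum of a [fps_mulX] can be supplied
    directly as [z * fps_eval f z]. *)
Lemma fps_eval_lin f x (u : K) g y (v : K) z :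
  series (fun k => f k * z ^+ k) @ \oo --> u ->
  series (fun k => g k * z ^+ k) @ \oo --> v ->
  fps_eval (fun n => x * f n + y * g n) z = x * u + y * v.
Proof.
move=> cvf cvg; apply/cvg_lim => //.
rewrite (_ : series _ = (fun n => x * series (fun k => f k * z ^+ k) n +
                                  y * series (fun k => g k * z ^+ k) n)).
  by apply: cvgD; apply: cvgMl_tmp.
apply/funext => n; rewrite !seriesEnat /= !mulr_sumr -big_split.
by apply: eq_bigr => i _ /=; ring.
Qed.

End Evaluation.

Section Bilinear.
Variable K : numFieldType.
Variables (x y c : K) (s t : seq K).
Hypothesis c_pos : ~ nonpos_integer c.

(** Here [x] and [y] stand for $a_1$ and $a_2$, [s] for $a_3,\dots,a_r$ and [t] for $\mathbf b$. *)
Let A := hypergeom [:: x, y + 1 & shift1 s] (c + 1 :: shift1 t).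
Let B := hypergeom [:: y, x + 1 & shift1 s] (c + 1 :: shift1 t).
Let C := hypergeom [:: y - 1, x & s] (c :: t).
Let D := hypergeom [:: x - 1, y & s] (c :: t).
Let E := hypergeom [:: x, y & s] (c :: t).
Let H := hypergeom [:: x, y & shift1 s] (c :: shift1 t).
Let P := (\prod_(u <- s) u) / (c * \prod_(u <- t) u).
Let kappa := x * (y * \prod_(u <- s) u) * (x - y) / (c * \prod_(u <- t) u).

Let kappaE : kappa = x * y * P * (x - y).
Proof. by rewrite /kappa /P; ring. Qed.

Let DE : D = (fun n => 1 * E n + - (y * P) * fps_mulX A n).
Proof.
by apply/funext => n; rewrite mul1r mulNr /D hypergeom_pred !big_cons mulrA.
Qed.

Let CE : C = (fun n => 1 * E n + - (x * P) * fps_mulX B n).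
Proof.
apply/funext => n.
(* The swap brings [y], the parameter lowered in [C], to the head of [E]. *)
by rewrite mul1r mulNr /C /E (hypergeom_swap x y s) hypergeom_pred !big_cons mulrA.
Qed.

(** The term [0 * H n] pads the left side to the two-term shape of [fps_mul_lin] and [fps_eval_lin],
    as the factor 1 does in [DE] and [CE]. *)
Let HE : (fun n => c * (y - x) * H n + 0 * H n) =
         (fun n => x * (y - c) * B n + - (y * (x - c)) * A n).
Proof.
by apply/funext => n; rewrite mul0r addr0 mulNr; apply: hypergeom_contiguous.
Qed.

Lemma hypergeom_bilinear n :
  x * (y - c) * fps_mul B D n - y * (x - c) * fps_mul A C n
    - c * (y - x) * fps_mul E H n = kappa * fps_mulX (fps_mul A B) n.
Proof using c_pos.
(* Multiplying [HE] by [E] expresses the product of [E] and [H] through those of [E] with [B] and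
   [A]. *)
have /(congr1 (fun f => f n)) := congr1 (fps_mul E) HE.
rewrite !fps_mul_lin mul0r addr0 => ->.
rewrite DE CE !fps_mul_lin !fps_mul_mulX (fps_mulC E B) (fps_mulC E A) (fps_mulC B A) kappaE.
by ring.
Qed.

Lemma hypergeom_eval_bilinear z :
  fps_cvg A z -> fps_cvg B z -> fps_cvg E z -> fps_cvg H z ->
  x * (y - c) * (fps_eval B z * fps_eval D z)
    - y * (x - c) * (fps_eval A z * fps_eval C z)
    - c * (y - x) * (fps_eval E z * fps_eval H z)
  = z * kappa * (fps_eval A z * fps_eval B z).
Proof using c_pos.
move=> cvA cvB cvE cvH.
have := congr1 (fun f => fps_eval f z) HE.
rewrite (fps_eval_lin _ _ cvH cvH) (fps_eval_lin _ _ cvB cvA) mul0r addr0.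
rewrite DE (fps_eval_lin _ _ cvE (fps_cvg_mulX cvA)).
rewrite CE (fps_eval_lin _ _ cvE (fps_cvg_mulX cvB)).
(* The limits supplied by the convergence hypotheses are unfolded; they are folded back to match the
   goal. *)
rewrite -!/(fps_eval _ z) kappaE => eqH.
have -> : c * (y - x) * (fps_eval E z * fps_eval H z) =
          fps_eval E z * (c * (y - x) * fps_eval H z) by ring.
by rewrite eqH; ring.
Qed.

End Bilinear.

Theorem theorem4p4 (R : realType) (r s : nat) (hr : (2 <= r)%N)
    (a : r.-tuple R[i]) (b : s.-tuple R[i]) (c : R[i])
    (hc : ~ nonpos_integer c)
    (hb : forall j : 'I_s, ~ nonpos_integer (tnth b j)) :
  let a1 := nth 0 a 0 in
  let a2 := nth 0 a 1 in
  let A := hypergeom (a1 :: shift1 (omit 0 a)) (c + 1 :: shift1 b) in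
  let B := hypergeom (a2 :: shift1 (omit 1 a)) (c + 1 :: shift1 b) in
  let C := hypergeom (a2 - 1 :: omit 1 a) (c :: b) in
  let D := hypergeom (a1 - 1 :: omit 0 a) (c :: b) in
  let E := hypergeom a (c :: b) in
  let H := hypergeom [:: a1, a2 & shift1 (omit 0 (omit 1 a))]
                     (c :: shift1 b) in
  let kappa := (\prod_(i < r) tnth a i) * (a1 - a2)
               / (c * \prod_(j < s) tnth b j) in
  (forall n : nat,
     a1 * (a2 - c) * fps_mul B D n - a2 * (a1 - c) * fps_mul A C n
       - c * (a2 - a1) * fps_mul E H n
     = kappa * fps_mulX (fps_mul A B) n)
  /\
  (forall z : R[i],
     fps_cvg A z -> fps_cvg B z -> fps_cvg C z ->
     fps_cvg D z -> fps_cvg E z -> fps_cvg H z ->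
     a1 * (a2 - c) * (fps_eval B z * fps_eval D z)
       - a2 * (a1 - c) * (fps_eval A z * fps_eval C z)
       - c * (a2 - a1) * (fps_eval E z * fps_eval H z)
     = z * kappa * (fps_eval A z * fps_eval B z)).
Proof.
(* The bound on [r] and the indexed products are restated on the underlying sequences, so that
   [tval a] can be split into its first two entries and the rest. *)
have : (2 <= size a)%N by rewrite size_tuple.
rewrite -(big_tuple _ _ a xpredT id) -(big_tuple _ _ b xpredT id).
case: (tval a) => [|x [|y u]] // _ a1 a2 A B C D E H kappa.
have kappaE : kappa = x * (y * \prod_(v <- u) v) * (x - y) / (c * \prod_(v <- b) v).
  by rewrite /kappa !big_cons.
rewrite kappaE /A /B /C /D /E /H /a1 /a2 /omit /= !drop0.
split=> [n|z cvA cvB _ _ cvE cvH]; first exact: (@hypergeom_bilinear _ x y c u b hc n).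
exact: (@hypergeom_eval_bilinear _ x y c u b hc z cvA cvB cvE cvH).
Qed.
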